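(* Let $G$ be a connected graph with $n \ge 2$ vertices. Then $G$ has a size-$2$ pinnacle set if and only if $G \ne K_n$ (i.e., $G$ is not a complete graph). Furthermore, when $G \ne K_n$, the poset $\mathcal{P}(G,2)$ is a linear order whose minimum element is $\{s^*, n\}$, where $s^* = n - \max\{\alpha_v : v \in V(G)\}$ and $\alpha_v$ is the size (number of vertices) of the largest connected component of $G - N[v]$, the subgraph of $G$ obtained by removing $v$ and all its neighbors.
   Context: Graphs are finite and simple, and $[n] = \{1,2,\ldots,n\}$. A labeling of a graph $G$ with $n$ vertices is a bijection $\lambda : V(G) \to [n]$. The label $\lambda(u)$ of a vertex $u$ is a pinnacle of $(G,\lambda)$ if $\lambda(u) > \lambda(v)$ for every neighbor $v$ of $u$. The pinnacle set of $(G,\lambda)$ is the set of all pinnacles of $(G,\lambda)$. A subset $S \subseteq [n]$ is a pinnacle set of $G$ if there is a labeling $\lambda$ of $G$ such that $S$ is the pinnacle set of $(G,\lambda)$. $\mathrm{Pin}(G,k)$ denotes the collection of all size-$k$ pinnacle sets of $G$. For $P = \{p_1 < p_2 < \cdots < p_k\}$ and $Q = \{q_1 < q_2 < \cdots < q_k\}$ in $\mathrm{Pin}(G,k)$, define $P \preceq Q$ if and only if $p_i \le q_i$ for $i = 1, \ldots, k$. Then $\mathcal{P}(G,k) = (\mathrm{Pin}(G,k), \preceq)$ is a partial order. A minimum element is one that is $\preceq$ every element of the poset. If $G - N[v]$ has no vertices, then $\alpha_v = 0$. *)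

(* Defs.v *)
From mathcomp Require Import all_boot.

Set Implicit Arguments.
Unset Strict Implicit.
Unset Printing Implicit Defensive.

(* A finite simple graph is a finType V of vertices with a symmetric and
   irreflexive adjacency relation e : rel V. *)

Definition simple_graph (V : finType) (e : rel V) : Prop :=
  symmetric e /\ irreflexive e.

Definition connected_graph (V : finType) (e : rel V) : Prop :=
  forall x y : V, connect e x y.

Definition complete_graph (V : finType) (e : rel V) : Prop :=
  forall x y : V, x != y -> e x y.

(* Labels live in 'I_(#|V|.+1) = {0, ..., n} so that a label is its own
   numerical value; [n] = {1, ..., n} is the set of nonzero elements. *)
Definition label (V : finType) : finType := 'I_(#|V|.+1).

Definition is_labeling (V : finType) (lam : {ffun V -> label V}) : bool :=
  injectiveb lam && (lam @: [set: V] == [set i : label V | 0 < i]).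

Definition pinnacle_set (V : finType) (e : rel V) (lam : {ffun V -> label V}) :
    {set label V} :=
  [set lam u | u : V & [forall v, e u v ==> (lam v < lam u)]].

Definition Pin (V : finType) (e : rel V) (k : nat) : {set {set label V}} :=
  [set S : {set label V} | (#|S| == k) &&
    [exists lam : {ffun V -> label V},
       is_labeling lam && (pinnacle_set e lam == S)]].

(* [enum P] lists the elements of P : {set 'I_m} in increasing order, so
   [nth ord0 (enum P) i] is the element p_(i+1) of P = {p_1 < ... < p_k}. *)
Definition pin_le (V : finType) (k : nat) : rel {set label V} :=
  fun P Q => [forall i : 'I_k,
    nth (ord0 : label V) (enum P) i <= nth (ord0 : label V) (enum Q) i].

Definition linear_order_on (T : finType) (D : {set T}) (r : rel T) : Prop :=
  [/\ {in D, reflexive r}, {in D &, antisymmetric r},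
      {in D & &, transitive r} & {in D &, total r}].

Definition minimum_of (T : finType) (D : {set T}) (r : rel T) (m : T) : Prop :=
  m \in D /\ {in D, forall x, r m x}.

Definition closed_nbhd (V : finType) (e : rel V) (v : V) : {set V} :=
  [set u | (u == v) || e v u].

Definition induced (V : finType) (e : rel V) (A : {set V}) : rel V :=
  [rel x y | [&& x \in A, y \in A & e x y]].

Definition components (V : finType) (e : rel V) (A : {set V}) :
    {set {set V}} :=
  equivalence_partition (connect (induced e A)) A.

(* The maximum over an empty family is 0, hence alpha e v = 0 when every
   vertex belongs to the closed neighbourhood of v. *)
Definition alpha (V : finType) (e : rel V) (v : V) : nat :=
  \max_(C in components e (~: closed_nbhd e v)) #|C|.

(* As s_star e <= #|V|, the label [inord (s_star e)] has value s_star e. *)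
Definition s_star (V : finType) (e : rel V) : nat :=
  #|V| - \max_(v : V) alpha e v.

(* Main.v *)
Require Import Defs.
From mathcomp Require Import all_boot.

Set Implicit Arguments.
Unset Strict Implicit.
Unset Printing Implicit Defensive.

(** Write n for the number of vertices.  The label n is always a pinnacle, so
    a size-2 pinnacle set is a pair {s, n} with s < n; comparing two of them
    amounts to comparing their smaller elements, and the order is linear.

    Lower bound on s ([s_star_le_pinnacle]).  Let v carry the label s.  From
    any vertex labeled above s one can climb to neighbors of ever larger
    label; the climb can only stop at a pinnacle larger than s, that is, at
    the vertex labeled n.  As v is a pinnacle, no vertex of N[v] has a label
    above s, so every climb stays inside G - N[v].  Hence the n - s vertices
    labeled above s lie in one component of G - N[v], and n - s is at most
    alpha_v.

    The bound is attained ([cohesive_pair_in_Pin]).  Let C be a nonempty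
    component of G - N[v].  List the vertices of C so that each one except the
    last has a neighbor further right; put v in front; then extend the list to
    the left with all other vertices, again so that each of the added vertices
    has a neighbor further right, which is possible since G is connected.
    Labeling by position, the pinnacles are exactly n and the label n - #|C|
    of v.  Taking v and C with #|C| maximal gives {s*, n}.

    Finally, a complete graph has a single pinnacle, as two pinnacles cannot
    be adjacent, while two distinct nonadjacent vertices x, y show that
    G - N[x] is nonempty and hence that the construction applies. *)

Lemma eq_imset_mem (aT rT : finType) (f : aT -> rT) (A B : {pred aT}) :
  A =i B -> f @: A = f @: B.
Proof.
by move=> AB; apply/setP=> y; apply/imsetP/imsetP=> -[x xA ->]; exists x;
  rewrite ?AB // -?AB.
Qed.

(** * Two-element label sets and their order *)

Lemma card_ord_gt (n s : nat) : #|[set i : 'I_n.+1 | s < i]| = n - s.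
Proof.
rewrite -sum1_card (eq_bigl (fun i : 'I_n.+1 => s < i)); last first.
  by move=> i; rewrite inE.
rewrite -(big_geq_mkord s.+1 n.+1 xpredT (fun=> 1)) sum_nat_const_nat.
by rewrite subSS muln1.
Qed.

Lemma enum_set2_ord (n : nat) (i j : 'I_n) :
  i < j -> enum [set i; j] = [:: i; j].
Proof.
move=> ltij; pose r := [rel a b : 'I_n | a < b].
have r_tr : transitive r by move=> b a c /=; apply: ltn_trans.
apply: (irr_sorted_eq r_tr) => [a||/=|a]; first by rewrite /= ltnn.
- rewrite /enum_mem; apply: sorted_filter => //.
  rewrite -enumT -(@sorted_map _ _ val ltn) val_enum_ord.
  exact: iota_ltn_sorted.
- by rewrite ltij.
- by rewrite mem_enum !inE.
Qed.

Lemma pin_le_pairs (V : finType) (s t : label V) :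
  s < #|V| -> t < #|V| ->
  pin_le 2 [set s; ord_max : label V] [set t; ord_max : label V] = (s <= t).
Proof.
move=> lts ltt; rewrite /pin_le !enum_set2_ord //.
apply/forallP/idP => [/(_ ord0) //|le_st i].
by case: i => [[|[|]]].
Qed.

(** * The smaller pinnacle is at least s* *)

Section LowerBound.

Variables (V : finType) (e : rel V).
Hypotheses (e_sym : symmetric e) (e_irr : irreflexive e).
Hypothesis V_gt0 : 0 < #|V|.

Section Labeling.

Variable lam : {ffun V -> label V}.
Hypothesis lam_lab : is_labeling lam.

Let lam_inj : injective lam.
Proof. by case/andP: lam_lab => /injectiveP. Qed.

Lemma labeling_surj (i : label V) : 0 < i -> exists x, lam x = i.
Proof.
case/andP: lam_lab => _ /eqP im i_gt0.
have: i \in lam @: [set: V] by rewrite im inE.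
by case/imsetP=> x _ ->; exists x.
Qed.

Lemma ord_max_pinnacle : (ord_max : label V) \in pinnacle_set e lam.
Proof.
have [u lam_u] := @labeling_surj (ord_max : label V) V_gt0.
rewrite -lam_u; apply/imsetP; exists u => //; rewrite inE.
apply/forallP=> w; apply/implyP=> euw.
rewrite lam_u ltn_neqAle -ltnS ltn_ord andbT.
apply: contraTneq euw => lam_w.
have -> : w = u by apply: lam_inj; rewrite lam_u; apply: val_inj.
by rewrite e_irr.
Qed.

Lemma card_above (s : nat) : #|[set x | s < lam x]| = #|V| - s.
Proof.
rewrite -(card_ord_gt #|V| s) -(card_imset _ lam_inj).
apply: eq_card => i; rewrite inE; apply/imsetP/idP.
  by case=> x; rewrite inE => + ->.
move=> lti; have [|x lam_x] := @labeling_surj i.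
  exact: leq_ltn_trans lti.
by exists x => //; rewrite inE lam_x.
Qed.

(** Climbing: a vertex labeled above s is not a pinnacle unless it is u, so it
    has a higher neighbor, which is again labeled above s and so lies in A. *)
Lemma above_connected (s : nat) (u : V) (A : {set V}) :
  lam u = ord_max ->
  (forall x, s < lam x -> x \in A) ->
  (forall i, i \in pinnacle_set e lam -> s < i -> i = ord_max) ->
  forall x, s < lam x -> connect (induced e A) u x.
Proof.
move=> lam_u sA only x.
have [m] := ubnP (#|V| - lam x); elim: m x => // m IHm x lem sx.
have [->|neq_xu] := eqVneq x u; first exact: connect0.
have: ~~ [forall w, e x w ==> (lam w < lam x)].
  apply: contra neq_xu => pk; apply/eqP/lam_inj.
  by rewrite lam_u; apply: only sx; apply/imsetP; exists x; rewrite ?inE.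
rewrite negb_forall => /existsP[y]; rewrite negb_imply -leqNgt.
case/andP=> exy le_xy.
have lt_xy : lam x < lam y.
  rewrite ltn_neqAle le_xy andbT; apply: contraTneq exy => eq_xy.
  have -> : y = x by apply: lam_inj; apply: val_inj.
  by rewrite e_irr.
have sy : s < lam y := ltn_trans sx lt_xy.
apply: (@connect_trans _ _ y).
  apply: IHm => //; rewrite ltnS in lem; apply: leq_trans lem.
  apply: ltn_sub2l => //; apply: leq_trans lt_xy _.
  by rewrite -ltnS ltn_ord.
by apply: connect1; rewrite /induced /= !sA // e_sym.
Qed.

Lemma s_star_le_pinnacle (s : label V) :
  s < #|V| -> pinnacle_set e lam = [set s; ord_max : label V] ->
  s_star e <= s.
Proof.
move=> lts pinE.
have /imsetP[v] : s \in pinnacle_set e lam by rewrite pinE !inE eqxx.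
rewrite inE => /forallP pkv s_v.
have [u lam_u] := @labeling_surj (ord_max : label V) V_gt0.
set A := ~: closed_nbhd e v.
have sA x : s < lam x -> x \in A.
  move=> lt_sx; rewrite !inE negb_or; apply/andP; split.
    by apply: contraTneq lt_sx => ->; rewrite s_v ltnn.
  apply: contraTN lt_sx => evx; rewrite -leqNgt s_v ltnW //.
  exact: (implyP (pkv x)).
have uA : u \in A by apply: sA; rewrite lam_u.
have only i : i \in pinnacle_set e lam -> s < i -> i = ord_max.
  by rewrite pinE !inE => /orP[] /eqP-> //; rewrite ltnn.
pose C := [set y in A | connect (induced e A) u y].
have C_comp : C \in components e A by apply/imsetP; exists u.
have le_C : #|V| - s <= #|C|.
  rewrite -card_above; apply/subset_leq_card/subsetP=> x; rewrite !inE => sx.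
  have := sA _ sx; rewrite !inE => -> /=.
  exact: above_connected sx.
have le_alpha : #|V| - s <= \max_(w : V) alpha e w.
  apply: leq_trans le_C _; apply: leq_trans (leq_bigmax v).
  exact: (@leq_bigmax_cond _ (mem (components e A)) (fun D => #|D|) C).
by rewrite /s_star leq_subLR addnC -leq_subLR.
Qed.

End Labeling.

Lemma Pin2_pair (S : {set label V}) : S \in Pin e 2 ->
  exists s : label V,
    [/\ s < #|V|, S = [set s; ord_max : label V] & s_star e <= s].
Proof.
rewrite inE => /andP[cardS /existsP[lam /andP[lab /eqP pinE]]].
have maxS : (ord_max : label V) \in S by rewrite -pinE ord_max_pinnacle.
have [s neq_s SE] : exists2 s : label V,
    s != ord_max & S = [set s; ord_max : label V].
  have /cards1P[s Ds] : #|S :\ (ord_max : label V)| == 1.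
    by move: cardS; rewrite (cardsD1 (ord_max : label V)) maxS.
  exists s; last by rewrite -(setD1K maxS) Ds setUC.
  have: s \in S :\ (ord_max : label V) by rewrite Ds inE.
  by rewrite !inE => /andP[].
have lts : s < #|V|.
  rewrite ltn_neqAle -[(s <= _)]ltnS ltn_ord andbT.
  by apply: contraNneq neq_s => sE; apply/eqP/val_inj.
by exists s; split=> //; apply: s_star_le_pinnacle lab _ lts _; rewrite pinE.
Qed.

End LowerBound.

(** * Labelings with prescribed pinnacles *)

(** Connectedness of the subgraph induced on B, in the form that the greedy
    construction consumes: a partial list can always be enlarged. *)
Definition cohesive (V : finType) (e : rel V) (B : {set V}) :=
  forall D : {set V}, D \proper B -> D != set0 ->
  exists x y, [/\ x \in B :\: D, y \in D & e x y].

Section Construction.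

Variables (V : finType) (e : rel V).
Hypothesis e_sym : symmetric e.

Lemma component_cohesive (A : {set V}) (C : {set V}) :
  C \in components e A -> cohesive e C.
Proof.
case/imsetP=> x xA CE D /properP[sDC [z zC zD]] /set0Pn[d dD].
have /existsP[a /existsP[b /and3P[aB bD eab]]] :
    [exists a, exists b, [&& a \in C :\: D, b \in D & e a b]];
  last by exists a, b.
(* Without such an edge D would be closed under adjacency inside A, and so
   could not separate d from z. *)
apply: contraNT zD; rewrite negb_exists => /forallP no_edge.
have ind_sym : symmetric (induced e A).
  by move=> a b; rewrite /induced /= e_sym andbCA.
have inC a : a \in C -> connect (induced e A) x a.
  by rewrite CE inE => /andP[].
have clD : closed (induced e A) (mem D).
  apply: (intro_closed (sym_connect_sym ind_sym)) => a b /= iab aD.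
  apply: contraNT (no_edge b) => bD; apply/existsP; exists a.
  have /and3P[aA bA eab] := iab.
  rewrite inE bD aD e_sym eab /= !andbT CE inE bA /=.
  exact: connect_trans (inC a (subsetP sDC a aD)) (connect1 iab).
have dz : connect (induced e A) d z.
  apply: connect_trans (inC z zC).
  by rewrite (sym_connect_sym ind_sym) inC // (subsetP sDC).
by rewrite -[z \in D](closed_connect clD dz).
Qed.

Lemma connected_cohesive : connected_graph e -> cohesive e [set: V].
Proof.
move=> conn D pD Dn0; have /set0Pn[d _] := Dn0.
apply: (@component_cohesive [set: V]) pD Dn0; apply/imsetP; exists d => //.
apply/setP=> y; rewrite !inE (@eq_connect _ _ e) ?conn // => a b.
by rewrite /induced /= !inE.
Qed.

Definition later_nbr (s : seq V) (x : V) :=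
  [exists y, [&& y \in s, e x y & index x s < index y s]].

(** Extending a list to the left only adds earlier vertices. *)
Lemma later_nbr_cat (t s : seq V) (x : V) :
  uniq (t ++ s) -> x \in s -> later_nbr (t ++ s) x = later_nbr s x.
Proof.
rewrite cat_uniq => /and3P[_ /hasPn/= st _] xs.
rewrite /later_nbr; apply/existsP/existsP => -[y /and3P[ys exy]];
  rewrite !index_cat (negbTE (st x xs)).
- case: ifP => [yt|/negbT yt].
    by rewrite ltnNge ltnW // ltn_addr ?index_mem.
  rewrite ltn_add2l => lt_xy; exists y; rewrite exy lt_xy !andbT.
  by move: ys; rewrite mem_cat (negbTE yt).
- move=> lt_xy; exists y; rewrite mem_cat ys orbT exy /=.
  by rewrite index_cat (negbTE (st y ys)) ltn_add2l.
Qed.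

(** Every new vertex is put in front of a list that already contains one of
    its neighbors, so that this neighbor comes later. *)
Lemma cohesive_grow (B : {set V}) (s : seq V) :
  cohesive e B -> uniq s -> s != [::] -> {subset s <= B} ->
  exists t, [/\ uniq (t ++ s), t ++ s =i B
              & {in t, forall x, later_nbr (t ++ s) x}].
Proof.
move=> cohB; have [m] := ubnP (#|B| - size s).
elim: m s => // m IHm s lem s_uniq s_n0 sB.
have sDB : [set z in s] \subset B by apply/subsetP=> z; rewrite inE => /sB.
have [pD|npD] := boolP ([set z in s] \proper B); last first.
  exists [::]; split=> // z; apply/idP/idP=> [/sB //|zB].
  move: npD; rewrite properE sDB negbK => /subsetP/(_ z zB).
  by rewrite inE.
have [|x [y [xBs]]] := cohB _ pD.
  case: s s_n0 {lem s_uniq sB sDB pD} => // a s _.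
  by apply/set0Pn; exists a; rewrite !inE eqxx.
move: xBs; rewrite !inE => /andP[xs xB] ys exy.
have xs_uniq : uniq (x :: s) by rewrite /= xs.
have xsB : {subset x :: s <= B}.
  by move=> z; rewrite inE => /predU1P[->|/sB].
have lt_sB : size s < #|B|.
  by have := proper_card pD; rewrite cardsE (card_uniqP s_uniq).
have [|//|t [t_uniq tB t_later]] := IHm (x :: s) _ xs_uniq _ xsB.
  by rewrite ltnS in lem; apply: leq_trans lem; rewrite /= ltn_sub2l.
exists (rcons t x); rewrite cat_rcons; split=> // z.
rewrite mem_rcons inE => /predU1P[->|]; last exact: t_later.
rewrite later_nbr_cat ?mem_head //; apply/existsP; exists y.
rewrite inE ys orbT exy /= eqxx.
by case: eqVneq => // xy; rewrite xy ys in xs.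
Qed.

Definition position_labeling (s : seq V) : {ffun V -> label V} :=
  [ffun x => inord (index x s).+1].

Section Positions.

Variable s : seq V.
Hypotheses (s_uniq : uniq s) (s_all : forall x, x \in s).

Let size_s : size s = #|V|.
Proof. by rewrite -(card_uniqP s_uniq); apply: eq_card => x; rewrite s_all. Qed.

Lemma position_labelingE x : position_labeling s x = (index x s).+1 :> nat.
Proof. by rewrite ffunE inordK // ltnS -size_s index_mem. Qed.

Lemma position_labelingP : is_labeling (position_labeling s).
Proof.
have inj : injective (position_labeling s).
  move=> x y /(congr1 val) /=; rewrite !position_labelingE => -[eq_i].
  by rewrite -(nth_index x (s_all x)) eq_i nth_index.
apply/andP; split; first exact/injectiveP.
rewrite eqEcard card_imset // cardsT card_ord_gt subn0 leqnn andbT.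
by apply/subsetP=> _ /imsetP[x _ ->]; rewrite inE position_labelingE.
Qed.

Lemma position_pinnacles :
  irreflexive e ->
  pinnacle_set e (position_labeling s) =
    position_labeling s @: [set x | ~~ later_nbr s x].
Proof.
move=> e_irr; rewrite /pinnacle_set; apply: eq_imset_mem => x.
rewrite !inE negb_exists; apply: eq_forallb => y.
rewrite s_all !position_labelingE ltnS /= negb_and -leqNgt implybE.
have [exy|//] := boolP (e x y); rewrite /= [index y s <= _]leq_eqVlt.
case: eqVneq => // eq_i; move: exy.
by rewrite -(nth_index x (s_all y)) eq_i nth_index ?e_irr.
Qed.

End Positions.

(** The list is t2, v, t1, u with t1, u running through C: the only positions
    without a later neighbor are those of v, which has no neighbor in C, and
    of u, which comes last. *)
Lemma cohesive_pair_in_Pin (v : V) (C : {set V}) :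
  irreflexive e -> connected_graph e -> cohesive e C -> C != set0 ->
  C \subset ~: closed_nbhd e v ->
  [set (inord (#|V| - #|C|) : label V); ord_max : label V] \in Pin e 2.
Proof.
move=> e_irr e_conn cohC /set0Pn[u uC] /subsetP sC.
have not_nbr y : y \in C -> y != v /\ ~~ e v y.
  by move/sC; rewrite !inE negb_or => /andP[].
have [|t1 [r_uniq rC t1_later]] := @cohesive_grow C [:: u] cohC isT isT.
  by move=> z; rewrite inE => /eqP->.
set r := t1 ++ [:: u] in r_uniq rC t1_later.
have vr_uniq : uniq (v :: r).
  rewrite /= r_uniq andbT rC; apply/negP=> /not_nbr[].
  by rewrite eqxx.
have [|t2 [s_uniq s_all t2_later]] :=
    @cohesive_grow _ (v :: r) (connected_cohesive e_conn) vr_uniq isT.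
  by move=> z; rewrite in_setT.
set s := t2 ++ v :: r in s_uniq s_all t2_later.
have {}s_all x : x \in s by rewrite s_all inE.
have size_r : size r = #|C|.
  by rewrite -(card_uniqP r_uniq); apply: eq_card.
have size_s : size s = #|V|.
  by rewrite -(card_uniqP s_uniq); apply: eq_card => x; rewrite s_all.
have ur : u \in r by rewrite mem_cat mem_head orbT.
have uvr : u \in v :: r by rewrite inE ur orbT.
have no_later x : (~~ later_nbr s x) = (x \in [set v; u]).
  rewrite !inE; apply/idP/idP => [nlx|].
    have: x \in s by [].
    rewrite mem_cat => /orP[/t2_later xl|xvr]; first by rewrite xl in nlx.
    rewrite later_nbr_cat // in nlx.
    move: xvr; rewrite inE => /orP[-> //|xr].
    rewrite -cat1s later_nbr_cat // in nlx.
    move: xr; rewrite mem_cat mem_seq1 => /orP[/t1_later xl|->].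
      by rewrite xl in nlx.
    exact: orbT.
  case/orP=> /eqP->.
    rewrite later_nbr_cat ?mem_head //; apply/existsP=> -[y /and3P[]].
    rewrite inE => /predU1P[->|]; first by rewrite e_irr.
    by rewrite rC => /not_nbr[_ /negPf->].
  rewrite later_nbr_cat // -cat1s later_nbr_cat // later_nbr_cat ?mem_head //.
  by apply/existsP=> -[y /and3P[]]; rewrite inE => /eqP->; rewrite e_irr.
set lam := position_labeling s.
have lam_v : lam v = inord (#|V| - #|C|).
  rewrite /lam /position_labeling ffunE; congr inord.
  rewrite index_cat; case: ifP => [vt2|_].
    by move: s_uniq; rewrite cat_uniq /= vt2 andbF.
  by rewrite /= eqxx addn0 -size_s size_cat /= size_r -addSnnS addnK.
have lam_u : lam u = ord_max.
  apply: val_inj; rewrite /= position_labelingE // -size_s.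
  move: s_uniq; rewrite /s /r -cat_cons catA cats1.
  rewrite rcons_uniq => /andP[/negPf ut _]; rewrite -cats1.
  by rewrite index_cat ut /= eqxx addn0 cats1 size_rcons.
have pinE : pinnacle_set e lam = [set inord (#|V| - #|C|); ord_max : label V].
  rewrite position_pinnacles // -lam_v -lam_u -!imset_set1 -imsetU.
  by apply: eq_imset_mem => x; rewrite inE no_later.
rewrite inE; apply/andP; split; last first.
  by apply/existsP; exists lam; rewrite position_labelingP //= pinE.
rewrite cards2 -lam_v -lam_u.
case/andP: (position_labelingP s_uniq s_all) => /injectiveP lam_inj _.
have [neq_uv _] := not_nbr u uC.
by rewrite (inj_eq lam_inj) [v == u]eq_sym neq_uv.
Qed.

End Construction.

(** * The order on size-2 pinnacle sets *)

Lemma Pin2_not_complete (V : finType) (e : rel V) (S : {set label V}) :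
  S \in Pin e 2 -> ~ complete_graph e.
Proof.
rewrite inE => /andP[cardS /existsP[lam /andP[_ /eqP pinE]]] compl.
have /cards2P[a [b [neq_ab SE]]] := cardS.
have: a \in S by rewrite SE !inE eqxx.
have: b \in S by rewrite SE !inE eqxx orbT.
rewrite -pinE => /imsetP[y]; rewrite inE => /forallP pky b_y.
case/imsetP=> x; rewrite inE => /forallP pkx a_x.
have neq_xy : x != y.
  by apply: contraNneq neq_ab => eq_xy; rewrite a_x b_y eq_xy.
have lt_yx := implyP (pkx y) (compl x y neq_xy).
have: lam x < lam y by apply: (implyP (pky x)); apply: compl; rewrite eq_sym.
by rewrite ltnNge ltnW.
Qed.

Lemma max_alpha_gt0 (V : finType) (e : rel V) :
  ~ complete_graph e -> 0 < \max_(v : V) alpha e v.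
Proof.
move=> not_compl; rewrite lt0n; apply/eqP => max0.
apply: not_compl => x y neq_xy.
have alpha0 : alpha e x = 0.
  by apply/eqP; rewrite -leqn0 -max0; apply: leq_bigmax.
pose A := ~: closed_nbhd e x.
have [//|nexy] := boolP (e x y).
have yA : y \in A by rewrite !inE negb_or eq_sym neq_xy.
pose C := [set z in A | connect (induced e A) y z].
have: #|C| <= alpha e x.
  apply: (@leq_bigmax_cond _ (mem (components e A)) (fun D => #|D|) C).
  by apply/imsetP; exists y.
rewrite alpha0 leqn0 cards_eq0 => /eqP C0.
have: y \in C by rewrite inE yA connect0.
by rewrite C0 inE.
Qed.

Lemma max_alpha_component (V : finType) (e : rel V) :
  0 < \max_(v : V) alpha e v ->
  exists v, exists2 C, C \in components e (~: closed_nbhd e v) &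
    #|C| = \max_(v : V) alpha e v.
Proof.
move=> max_gt0.
have V_gt0 : 0 < #|V|.
  rewrite lt0n; apply: contraTneq max_gt0 => /card0_eq V0.
  by rewrite big_pred0.
have [v maxE] := @eq_bigmax _ (alpha e) V_gt0.
have comp_gt0 : 0 < #|components e (~: closed_nbhd e v)|.
  rewrite lt0n; apply: contraTneq max_gt0 => /card0_eq C0.
  by rewrite maxE /alpha big_pred0.
have [C C_comp CE] :=
  @eq_bigmax_cond _ (mem (components e (~: closed_nbhd e v)))
    (fun D => #|D|) comp_gt0.
by exists v, C; rewrite // maxE.
Qed.

Lemma s_star_pair_in_Pin (V : finType) (e : rel V) :
  simple_graph e -> connected_graph e -> ~ complete_graph e ->
  [set (inord (s_star e) : label V); inord #|V| : label V] \in Pin e 2.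
Proof.
move=> [e_sym e_irr] e_conn /max_alpha_gt0 max_gt0.
have [v [C C_comp CE]] := max_alpha_component max_gt0.
have -> : inord #|V| = ord_max :> label V by apply: val_inj; rewrite /= inordK.
rewrite /s_star -CE; apply: (@cohesive_pair_in_Pin _ _ e_sym v) => //.
- exact: component_cohesive C_comp.
- by rewrite -card_gt0 CE.
- by case/imsetP: C_comp => x _ ->; apply/subsetP=> z; rewrite inE => /andP[].
Qed.

Theorem theorem5p7 (V : finType) (e : rel V)
    (e_simple : simple_graph e) (e_conn : connected_graph e)
    (n_ge2 : 2 <= #|V|) :
  ((exists S : {set label V}, S \in Pin e 2) <-> ~ complete_graph e)
  /\ (~ complete_graph e ->
      linear_order_on (Pin e 2) (@pin_le V 2)
      /\ minimum_of (Pin e 2) (@pin_le V 2)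
           [set (inord (s_star e) : label V); (inord #|V| : label V)]).
Proof.
have [e_sym e_irr] := e_simple.
have V_gt0 : 0 < #|V| by apply: ltnW.
have pair S := @Pin2_pair V e e_sym e_irr V_gt0 S.
split; first split=> [[S] | not_compl]; first exact: Pin2_not_complete.
  by eexists; apply: s_star_pair_in_Pin.
move=> not_compl; have min_in := s_star_pair_in_Pin e_simple e_conn not_compl.
split; [split|split=> //].
- by move=> _ /pair[s [lts -> _]]; rewrite pin_le_pairs.
- move=> _ _ /pair[s [lts -> _]] /pair[t [ltt -> _]].
  by rewrite !pin_le_pairs // -eqn_leq => /eqP/val_inj->.
- move=> _ _ _ /pair[t [ltt -> _]] /pair[s [lts -> _]] /pair[r [ltr -> _]].
  by rewrite !pin_le_pairs //; apply: leq_trans.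
- move=> _ _ /pair[s [lts -> _]] /pair[t [ltt -> _]].
  by rewrite !pin_le_pairs // leq_total.
have s_starK : (inord (s_star e) : label V) = s_star e :> nat.
  by apply: inordK; rewrite ltnS leq_subr.
have s_star_lt : s_star e < #|V|.
  by rewrite ltn_subrL V_gt0 max_alpha_gt0.
have -> : inord #|V| = ord_max :> label V by apply: val_inj; rewrite /= inordK.
move=> _ /pair[t [ltt -> le_t]].
by rewrite pin_le_pairs ?s_starK.
Qed.
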